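(* Let $(\lambda_n)_{n\ge1}$ be a sequence in $(0,1)$ such that $\sum_{n=1}^\infty(1-\lambda_n)<\infty$ and put $$f_n(z):=z\,\frac{z+\lambda_n}{1+\lambda_n z},\qquad n\in\mathbb{N}.$$ Then the forward composition sequence $F_n:=f_n\circ\cdots\circ f_1$ has topological entropy zero on $\partial\mathbb{D}$; that is, $h_{\rm top}((f_n))=0$.
   Context: $\mathbb{D}=\{z\in\mathbb{C}:|z|<1\}$. Each $f_n$ is a degree two Blaschke product, and so maps $\partial\mathbb{D}$ continuously to itself. Topological entropy: let $F_0$ be the identity. For $n\ge 0$ and $\delta>0$, a subset $S$ of $\partial\mathbb{D}$ is called $(n,\delta)$-separated for $(f_n)$ if any two distinct points $\zeta,\zeta'\in S$ satisfy $$\max_{0\le k\le n}|F_k(\zeta)-F_k(\zeta')|\ge\delta.$$ Let $N(n,\delta)$ be the maximum cardinality of an $(n,\delta)$-separated subset of $\partial\mathbb{D}$ for $(f_n)$. Then $$h_{\rm top}((f_n)):=\lim_{\delta\to0}\limsup_{n\to\infty}\frac1n\log N(n,\delta).$$ *)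

(* Defs.v *)
From HB Require Import structures.
From mathcomp Require Import all_boot all_order all_algebra.
From mathcomp Require Import finmap.
From mathcomp Require Import complex.
From mathcomp Require Import all_classical all_reals all_analysis.

Set Implicit Arguments.
Unset Strict Implicit.
Unset Printing Implicit Defensive.

Import Order.TTheory GRing.Theory Num.Theory.
Import numFieldNormedType.Exports.

Local Open Scope classical_set_scope.
Local Open Scope ring_scope.
Local Open Scope complex_scope.

(* MathComp-Analysis, over R[i].  [Normc.normc z : R] is the modulus; the
   generic norm `|z| equals (Normc.normc z)%:C and lies in R[i]. *)

Definition unit_circle (R : realType) : set R[i] :=
  [set z | Normc.normc z = 1].

Definition blaschke2 (R : realType) (lambda : R) (z : R[i]) : R[i] :=
  z * ((z + lambda%:C) / (1 + lambda%:C * z)).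

(* F_n = f_n \o ... \o f_1 and F_0 = id; the value f 0 is never used. *)
Fixpoint fwd_comp (R : realType) (f : nat -> R[i] -> R[i]) (n : nat) :
    R[i] -> R[i] :=
  if n is m.+1 then f m.+1 \o fwd_comp f m else id.

(* The index k ranges over 0, ..., n inclusive; the terms are nonnegative, so
   the default value 0 of the iterated maximum is harmless. *)
Definition separated (R : realType) (f : nat -> R[i] -> R[i]) (n : nat)
    (delta : R) (S : set R[i]) : Prop :=
  S `<=` @unit_circle R /\
  forall z w, S z -> S w -> z <> w ->
    delta <= \big[Num.max/0]_(k < n.+1)
               Normc.normc (fwd_comp f k z - fwd_comp f k w).

(* The supremum in \bar R of the cardinalities of the finite separated sets.
   When these are bounded it is attained, hence a maximum, and every separated
   set is then finite (all subsets of a separated set are separated);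
   otherwise it is +oo. *)
Definition max_separated (R : realType) (f : nat -> R[i] -> R[i]) (n : nat)
    (delta : R) : \bar R :=
  ereal_sup [set (#|` S|%:R)%:E |
             S in [set S : {fset R[i]} | separated f n delta [set` S]]].

Definition separation_rate (R : realType) (f : nat -> R[i] -> R[i])
    (delta : R) : \bar R :=
  limn_esup (fun n : nat => (n%:R^-1)%:E * lne (max_separated f n delta))%E.

Definition htop (R : realType) (f : nat -> R[i] -> R[i]) : \bar R :=
  lim (separation_rate f delta @[delta --> 0^'+]).

Lemma max_separated_nonincreasing (R : realType) (f : nat -> R[i] -> R[i])
    (n : nat) (d e : R) :
  d <= e -> (max_separated f n e <= max_separated f n d)%E.
Proof.
move=> de; apply: ereal_sup_le => _ [S [Sc sepS] <-] /=; exists S => //=.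
by split=> // z w Sz Sw zw; apply: le_trans de _; exact: sepS.
Qed.

Lemma separation_rate_nonincreasing (R : realType) (f : nat -> R[i] -> R[i])
    (d e : R) :
  d <= e -> (separation_rate f e <= separation_rate f d)%E.
Proof.
move=> de; rewrite /separation_rate /limn_esup /limf_esup.
apply: le_ereal_inf_tmp => _ [V FV <-].
apply: (@le_trans _ _ (ereal_sup ((fun n : nat =>
  (n%:R^-1)%:E * lne (max_separated f n e))%E @` V))).
  by apply: ereal_inf_lbound; exists V.
apply: ge_ereal_sup => _ [n Vn <-].
apply: (@le_trans _ _ ((n%:R^-1)%:E * lne (max_separated f n d))%E); last first.
  by apply: ereal_sup_ubound; exists n.
have N0 x : (0 <= max_separated f n x)%E.
  apply: ereal_sup_ubound; exists fset0; last by rewrite cardfs0.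
  by split => [z|z w] /=; rewrite in_fset0.
apply: lee_wpmul2l; first by rewrite lee_fin invr_ge0.
by rewrite lee_lne ?in_itv/= ?N0 ?leey//; exact: max_separated_nonincreasing.
Qed.

(* The limit defining [htop] exists for every sequence f, so [htop] never
   takes the default value of [lim]. *)
Lemma htop_cvg (R : realType) (f : nat -> R[i] -> R[i]) :
  separation_rate f delta @[delta --> 0^'+] --> htop f.
Proof.
apply: nonincreasing_at_right_is_cvge; near=> b.
by move=> x y _ _; exact: separation_rate_nonincreasing.
Unshelve. all: by end_near. Qed.

(* Main.v *)
(* On the unit circle |f_n z - z| <= 4 (1 - lambda_n) / |1 + z|, so f_n is
   almost the identity away from -1.  Fix r > 0.  By summability there is N such
   that an orbit found outside the disc |1 + z| < r at some time k >= N never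
   again moves by more than r / 2.  Up to precision a multiple of r, an orbit of
   length n is thus determined by its cells (for a finite partition of the
   circle into small cells) at the times k < N, by the first time k >= N at which
   it is outside the disc, and by its cell at that time.  Hence separated sets
   have cardinality O(n). *)

Require Import Defs.
From mathcomp Require Import all_boot all_order all_algebra.
From mathcomp Require Import finmap ring lra zify.
From mathcomp Require Import complex.
From mathcomp Require Import all_classical all_reals all_analysis.

Import Order.TTheory GRing.Theory Num.Theory.
Import numFieldNormedType.Exports.

Local Open Scope classical_set_scope.
Local Open Scope ring_scope.

Lemma normc_ge0 (R : realType) (z : R[i]) : 0 <= Normc.normc z.
Proof. by case: z => a b; rewrite sqrtr_ge0. Qed.

Lemma normc_opp (R : realType) (z : R[i]) : Normc.normc (- z) = Normc.normc z.
Proof. by case: z => a b; rewrite /= !sqrrN. Qed.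

Lemma normcB (R : realType) (z w : R[i]) :
  Normc.normc (z - w) = Normc.normc (w - z).
Proof. by rewrite -normc_opp opprB. Qed.

Lemma normc_triangle (R : realType) (z w : R[i]) :
  Normc.normc (z + w) <= Normc.normc z + Normc.normc w.
Proof. exact: le_normcD. Qed.

Lemma normc_le_ReIm (R : realType) (a b : R) :
  Normc.normc (a +i* b)%C <= `|a| + `|b|.
Proof.
rewrite -[leRHS]ger0_norm ?addr_ge0// -sqrtr_sqr /= ler_wsqrtr//.
rewrite sqrrD !real_normK ?num_real// lerD2r lerDl.
by rewrite mulrn_wge0// mulr_ge0.
Qed.

(** * A single factor on the unit circle *)

Lemma blaschke2_denom_ge (R : realType) (l : R) (z : R[i]) :
  0 < l -> unit_circle z -> 1 - l <= Normc.normc (1 + l%:C%C * z).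
Proof.
move=> l0 z1; have e : 1 = (1 + l%:C%C * z) + - (l%:C%C * z) by ring.
have : Normc.normc (1 : R[i]) <= Normc.normc (1 + l%:C%C * z) + l.
  rewrite {1}e (le_trans (normc_triangle _ _ _))// lerD2l normc_opp.
  by rewrite Normc.normcM z1 mulr1 /= expr0n addr0 sqrtr_sqr ger0_norm// ltW.
rewrite Normc.normc1; lra.
Qed.

Lemma blaschke2_denom_gt0 (R : realType) (l : R) (z : R[i]) :
  0 < l < 1 -> unit_circle z -> 0 < Normc.normc (1 + l%:C%C * z).
Proof. by move=> /andP[l0 l1] z1; have := blaschke2_denom_ge _ _ _ l0 z1; lra. Qed.

(** In [1 + z = (1 + l * z) + (1 - l) * z] the last term has modulus [1 - l], which is at most
    [|1 + l * z|] by [blaschke2_denom_ge]. *)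
Lemma normc1D_le_denom (R : realType) (l : R) (z : R[i]) :
  0 < l < 1 -> unit_circle z ->
  Normc.normc (1 + z) <= 2 * Normc.normc (1 + l%:C%C * z).
Proof.
move=> /andP[l0 l1] z1; have ge := blaschke2_denom_ge _ _ _ l0 z1.
have e : 1 + z = (1 + l%:C%C * z) + (1 - l)%:C%C * z.
  by rewrite rmorphB rmorph1; ring.
suff : Normc.normc (1 + z) <= Normc.normc (1 + l%:C%C * z) + (1 - l) by lra.
rewrite {1}e (le_trans (normc_triangle _ _ _))// lerD2l Normc.normcM z1 mulr1.
by rewrite /= expr0n addr0 sqrtr_sqr ger0_norm// subr_ge0 ltW.
Qed.

(** For [|z| = 1] both [|z + l|^2] and [|1 + l * z|^2] equal [1 + 2 * l * Re z + l^2]. *)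
Lemma blaschke2_circle (R : realType) (l : R) (z : R[i]) :
  0 < l < 1 -> unit_circle z -> unit_circle (blaschke2 l z).
Proof.
move=> hl z1; have d0 := blaschke2_denom_gt0 _ _ _ hl z1.
rewrite /unit_circle /blaschke2 /= !Normc.normcM z1 mul1r Normc.normcV.
suff -> : Normc.normc (z + l%:C%C) = Normc.normc (1 + l%:C%C * z).
  by rewrite mulfV// gt_eqF.
move: z1; case: (z) => a b; rewrite /unit_circle /= => z1.
have {}z1 : a ^+ 2 + b ^+ 2 = 1.
  rewrite -[RHS](expr1n _ 2) -z1 sqr_sqrtr// addr_ge0 ?sqr_ge0//.
have b2 : b ^+ 2 = 1 - a ^+ 2 by lra.
congr Num.sqrt; ring: b2.
Qed.

(** The displacement is [z * (1 - l) * (z - 1) / (1 + l * z)], where [|z - 1| <= 2]. The product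
    form keeps the point -1 admissible. *)
Lemma blaschke2_displacement (R : realType) (l : R) (z : R[i]) :
  0 < l < 1 -> unit_circle z ->
  Normc.normc (blaschke2 l z - z) * Normc.normc (1 + z) <= 4 * (1 - l).
Proof.
move=> hl z1; have d0 := blaschke2_denom_gt0 _ _ _ hl z1.
have den := normc1D_le_denom _ _ _ hl z1.
have /andP[l0 l1] := hl.
have n0 : 1 + l%:C%C * z != 0.
  by apply/eqP => e; move: d0; rewrite e Normc.normc0 ltxx.
have e : (blaschke2 l z - z) * (1 + l%:C%C * z) = z * ((1 - l)%:C%C * (z - 1)).
  by rewrite /blaschke2 rmorphB rmorph1; field.
have {}e : Normc.normc (blaschke2 l z - z) * Normc.normc (1 + l%:C%C * z) <=
    2 * (1 - l).
  rewrite -Normc.normcM e !Normc.normcM z1 mul1r /= expr0n addr0 sqrtr_sqr.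
  have l1_ge0 : 0 <= 1 - l by lra.
  rewrite ger0_norm // [leLHS]mulrC ler_wpM2r//.
  rewrite (le_trans (normc_triangle _ _ _))// normc_opp z1 Normc.normc1; lra.
have := ler_wpM2l (normc_ge0 _ (blaschke2 l z - z)) den; lra.
Qed.

(** * Orbits found away from -1 *)

Lemma fwd_comp_circle (R : realType) (lambda : nat -> R) (n : nat) (z : R[i]) :
  (forall n : nat, (1 <= n)%N -> 0 < lambda n < 1) -> unit_circle z ->
  unit_circle (fwd_comp (fun n => blaschke2 (lambda n)) n z).
Proof.
by move=> hl z1; elim: n => //= n IH; apply: blaschke2_circle => //; exact: hl.
Qed.

(** As long as the orbit has moved by at most [r / 2] since time [k], it is at distance at least
    [r / 2] from -1, so the step of index [n] moves it by at most [8 / r * (1 - lambda n)]. These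
    bounds add up to at most [8 / r * (r^2 / 16) = r / 2], which closes the argument. *)
Lemma fwd_comp_trapped (R : realType) (lambda : nat -> R) (k j : nat)
    (r : R) (z : R[i]) (F := fwd_comp (fun n => blaschke2 (lambda n))) :
  (forall n : nat, (1 <= n)%N -> 0 < lambda n < 1) -> unit_circle z ->
  0 < r -> (k <= j)%N ->
  (forall i, \sum_(k.+1 <= n < i) (1 - lambda n) <= r ^+ 2 / 16) ->
  r <= Normc.normc (1 + F k z) ->
  Normc.normc (F j z - F k z) <= r / 2.
Proof.
move=> hl z1 r0 kj tail rk.
have small i : 8 / r * \sum_(k.+1 <= n < i) (1 - lambda n) <= r / 2.
  rewrite mulrAC ler_pdivrMr//; have := tail i; lra.
(* The induction carries the partial sum, since [r / 2] alone would not absorb one more step. *)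
suff H : Normc.normc (F j z - F k z) <=
    8 / r * \sum_(k.+1 <= n < j.+1) (1 - lambda n) by exact: le_trans H (small _).
elim: j kj => [|j IH].
  by rewrite leqn0 => /eqP ->; rewrite subrr Normc.normc0 big_geq// mulr0.
rewrite leq_eqVlt => /orP[/eqP <-|kj].
  by rewrite subrr Normc.normc0 big_geq// mulr0.
have {}IH := IH kj; have near := le_trans IH (small j.+1).
rewrite big_nat_recr//=.
have step := blaschke2_displacement _ _ _ (hl j.+1 isT) (fwd_comp_circle _ _ j _ hl z1).
have far : r / 2 <= Normc.normc (1 + F j z).
  have := normc_triangle _ (1 + F j z) (F k z - F j z).
  rewrite [_ + (_ - _)](_ : _ = 1 + F k z); last by ring.
  rewrite (normcB _ (F k z)); lra.
have disp : Normc.normc (F j.+1 z - F j z) <= 8 / r * (1 - lambda j.+1).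
  rewrite mulrAC ler_pdivlMr//.
  have := ler_wpM2l (normc_ge0 _ (F j.+1 z - F j z)) far; move: step => /=; lra.
have := normc_triangle _ (F j.+1 z - F j z) (F j z - F k z).
rewrite [_ + (_ - _)](_ : _ = F j.+1 z - F k z); last by ring.
rewrite mulrDr; lra.
Qed.

(** * Finite cells and small tails *)

Lemma unit_circle_cells (R : realType) (d : R) : 0 < d ->
  exists (C : finType) (c : R[i] -> C), forall z w,
    unit_circle z -> unit_circle w -> c z = c w -> Normc.normc (z - w) < d.
Proof.
(* The mesh [1 / m] is below [d / 2], as the real and imaginary parts each contribute up to one
   mesh. *)
move=> d0; set m := (Num.truncn (2 / d)).+1.
have m0 : 0 < m%:R :> R by rewrite ltr0n.
have md : 2 < d * m%:R.
  by rewrite -ltr_pdivrMl// mulrC truncnS_gt.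
(* On [-1, 1] the truncation ranges over 0, ..., 2m, with 2m reached at [x = 1], so [inord] leaves
   it unchanged. *)
pose g (x : R) : 'I_(m.*2).+1 := inord (Num.truncn ((x + 1) * m%:R)).
have gP x y : `|x| <= 1 -> `|y| <= 1 -> g x = g y -> `|x - y| * m%:R < 1.
  have itv t : `|t| <= 1 -> 0 <= (t + 1) * m%:R /\ (g t = Num.truncn ((t + 1) * m%:R) :> nat).
    rewrite ler_norml => /andP[t1 t2].
    have t0 : 0 <= (t + 1) * m%:R by rewrite mulr_ge0 ?ler0n//; lra.
    split => //; rewrite /g inordK// truncn_lt_nat//.
    rewrite -addn1 natrD -addnn natrD.
    have := ler_wpM2r (ltW m0) t2; lra.
  move=> /itv[x0 gx] /itv[y0 gy] /(congr1 val) /=; rewrite gx gy => e.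
  have := truncn_itv x0; have := truncn_itv y0; rewrite e -natr1.
  move=> /andP[? ?] /andP[? ?].
  rewrite -[X in _ * X](gtr0_norm m0) -normrM ltr_norml; apply/andP; split; lra.
exists ('I_(m.*2).+1 * 'I_(m.*2).+1)%type.
exists (fun z => (g (complex.Re z), g (complex.Im z))) => -[a b] [a' b'].
have bd (x y : R) : Normc.normc (x +i* y)%C = 1 -> `|x| <= 1 /\ `|y| <= 1.
  move=> /= e; have {}e : x ^+ 2 + y ^+ 2 = 1.
    by rewrite -[RHS](expr1n _ 2) -e sqr_sqrtr// addr_ge0 ?sqr_ge0.
  by split; rewrite -(@expr_le1 _ 2)// real_normK ?num_real// -e ?lerDl ?lerDr sqr_ge0.
move=> /bd[a1 b1] /bd[a1' b1'] [/= ga gb].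
apply: le_lt_trans (normc_le_ReIm _ _ _) _.
rewrite -(ltr_pM2r m0); have := gP _ _ a1 a1' ga; have := gP _ _ b1 b1' gb.
lra.
Qed.

Lemma summable_tail (R : realType) (u : nat -> R) (e : R) :
  0 < e -> (forall n, (1 <= n)%N -> 0 <= u n) ->
  (\sum_(1 <= n <oo) (u n)%:E < +oo)%E ->
  exists N, forall k i, (N <= k)%N -> \sum_(k.+1 <= n < i) u n <= e.
Proof.
(* The lower index 1 becomes a side condition, so nonnegativity is asked only where [u0] provides
   it. *)
move=> e0 u0; rewrite eseries_cond => hsum.
have uE0 k : true && (0 < k)%N -> (0 <= (u k)%:E)%E by rewrite lee_fin => /u0.
have /fine_cvgP[tail_fin /cvgr0Pnorm_lt /(_ _ e0) tail_lt] :=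
  nneseries_tail_cvg hsum uE0.
have [N _ HN] := filterI tail_fin tail_lt.
exists N => k i Nk; have [/= kfin klt] := HN k.+1 (leqW Nk).
rewrite (le_trans _ (le_trans (ler_norm _) (ltW klt)))//.
rewrite -lee_fin fineK// -sumEFin.
apply: le_trans (nneseries_lim_ge i (fun n _ => uE0 n)).
rewrite big_nat_cond [leRHS]big_nat_cond le_eqVlt; apply/orP; left; apply/eqP.
by apply: eq_bigl => -[|n]; rewrite ?andbF ?andbT.
Qed.

(** * Counting separated sets *)

Lemma card_separated_linear (R : realType) (lambda : nat -> R) (delta : R) :
  (forall n : nat, (1 <= n)%N -> 0 < lambda n < 1) ->
  (\sum_(1 <= n <oo) (1 - lambda n)%:E < +oo)%E -> 0 < delta ->
  exists K : nat, forall n (S : {fset R[i]}),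
    Defs.separated (fun n => blaschke2 (lambda n)) n delta [set` S] ->
    (#|` S| <= K * n.+2)%N.
Proof.
move=> hl hsum d0; set F := fwd_comp (fun n => blaschke2 (lambda n)).
(* Points with equal codes will stay within [2 * r = delta / 2] of each other up to time [n]. *)
pose r := delta / 4; have r0 : 0 < r by rewrite divr_gt0.
have [C [c cP]] := unit_circle_cells _ r r0.
have [||N tail] := summable_tail _ (fun n => 1 - lambda n) (r ^+ 2 / 16) _ _ hsum.
- by rewrite divr_gt0 ?exprn_gt0.
- by move=> n n1; rewrite subr_ge0 ltW//; case/andP: (hl n n1).
(* This counts the cells at the times below [N] and the cell at the exit time, independently of [n];
   the exit time itself takes at most [n + 2] values. *)
exists (#|{: {ffun 'I_N -> C} * C}|) => n S [Scirc Ssep].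
(* [exit z] is [n.+1] when the orbit stays near -1 from time N up to n; then
   only the first N cells matter. *)
pose away z k := (N <= k)%N && (r <= Normc.normc (1 + F k z)).
pose exit z := find (away z) (iota 0 n.+1).
have exit_le z : (exit z < n.+2)%N.
  by rewrite ltnS (leq_trans (find_size _ _))// size_iota.
pose code z : {ffun 'I_N -> C} * C * 'I_n.+2 :=
  ([ffun k : 'I_N => c (F k z)], c (F (exit z) z), Ordinal (exit_le z)).
rewrite -[n.+2 in leqRHS]card_ord -card_prod.
suff inj : {in S &, injective code}.
  rewrite -(size_map code) cardE; apply: uniq_leq_size => [|x _]; last by rewrite mem_enum.
  by rewrite map_inj_in_uniq ?fset_uniq.
move=> z w Sz Sw /= [cellsN cell_exit exit_eq].
have circ k y : y \in S -> unit_circle (F k y).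
  by move=> Sy; apply: fwd_comp_circle => //; exact: Scirc.
apply: contrapT => zw; have := Ssep _ _ Sz Sw zw; apply/negP; rewrite -ltNge.
apply: bigmax_lt => // -[k /= kn] _.
have [kN|Nk] := ltnP k N.
  apply: (@lt_trans _ _ r); last by rewrite /r; lra.
  apply: cP; [exact: circ|exact: circ|].
  by move/ffunP: cellsN => /(_ (Ordinal kN)); rewrite !ffunE.
(* Before the common exit time both points are within [r] of -1. *)
have [kexit|exitk] := ltnP k (exit z).
  have close y : (k < exit y)%N -> Normc.normc (1 + F k y) < r.
    move=> /(before_find 0); rewrite nth_iota// add0n /away Nk /= => /negbT.
    by rewrite -ltNge.
  have cz := close _ kexit; have cw : Normc.normc (1 + F k w) < r.
    by apply: close; rewrite -exit_eq.
  have := normc_triangle _ (1 + F k z) (- (1 + F k w)).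
  rewrite normc_opp [_ + - _](_ : _ = F k z - F k w); last by ring.
  by move: cz cw; rewrite /r -/F; lra.
(* Since [k <= n], the search did not end on its default value [n.+1]. *)
have awayP y : (exit y <= k)%N -> away y (exit y).
  move=> exity; have : has (away y) (iota 0 n.+1).
    by rewrite has_find size_iota (leq_ltn_trans exity).
  move=> /(nth_find 0); rewrite nth_iota ?add0n//.
  exact: leq_ltn_trans exity kn.
have stay y : y \in S -> (exit y <= k)%N ->
    Normc.normc (F k y - F (exit y) y) <= r / 2.
  move=> Sy exity; have /andP[Ny ry] := awayP _ exity.
  apply: fwd_comp_trapped => //; first exact: Scirc.
  by move=> i; exact: tail.
have stayz := stay _ Sz exitk; have stayw := stay w Sw.
have cell := cP _ _ (circ _ _ Sz) (circ _ _ Sw) cell_exit.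
have {}stayw : Normc.normc (F (exit w) w - F k w) <= r / 2.
  by rewrite normcB; apply: stayw; rewrite -exit_eq.
(* Going from [F k z] to [F k w] through the two exit positions costs at most [r / 2], then [r],
   then [r / 2]. *)
have := normc_triangle _ (F k z - F (exit z) z) (F (exit z) z - F (exit w) w).
have := normc_triangle _ (F k z - F (exit w) w) (F (exit w) w - F k w).
rewrite [_ + (_ - _)](_ : _ = F k z - F k w); last by ring.
rewrite [X in _ -> Normc.normc X <= _ -> _](_ : _ = F k z - F (exit w) w); last by ring.
move: cell stayz stayw; rewrite /r -/F; lra.
Qed.

(** * From linear growth to zero entropy *)

Lemma htop_eq0_linear (R : realType) (f : nat -> R[i] -> R[i]) :
  (forall delta : R, 0 < delta -> exists K : nat, forall n (S : {fset R[i]}),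
    Defs.separated f n delta [set` S] -> (#|` S| <= K * n.+2)%N) ->
  htop f = 0%E.
Proof.
move=> flin.
suff rate0 delta : 0 < delta -> separation_rate f delta = 0%E.
  apply: cvg_lim => //; apply: cvg_near_cst; near=> delta; apply: rate0.
  by near: delta; exact: nbhs_right_gt.
move=> delta0; have [K HK] := flin _ delta0.
(* A singleton is separated, which makes the logarithms nonnegative. *)
have N1 n : (1 <= max_separated f n delta)%E.
  apply: ereal_sup_ubound; exists [fset 1]%fset; last by rewrite cardfs1.
  split => [z|z w] /=; rewrite !in_fset1.
    by move=> /eqP ->; exact: Normc.normc1.
  by move=> /eqP -> /eqP ->.
have NK n : (max_separated f n delta <= (K * n.+2)%:R%:E)%E.
  apply: ge_ereal_sup => _ [S Ssep <-]; rewrite lee_fin ler_nat; exact: HK.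
apply/eqP; rewrite eq_le; apply/andP; split; last first.
  apply: limf_esup_ge0 => [[n _ /(_ n)]|n]; first by apply => /=.
  by rewrite mule_ge0 ?lne_ge0// lee_fin invr_ge0.
apply/lee_addgt0Pr => e e0; rewrite add0e.
(* For [n >= N] this gives [6 * K < e^2 * n], hence [K * (n + 2) <= 3 * K * n <= (e * n)^2 / 2 <=
   exp (e * n)]. The successor ensures [n >= 1]. *)
set N := (Num.truncn (6 * K%:R / e ^+ 2)).+1.
apply: (@le_trans _ _ (ereal_sup ((fun n : nat =>
    (n%:R^-1)%:E * lne (max_separated f n delta))%E @` [set n | (N <= n)%N]))).
  by apply: ereal_inf_lbound; exists [set n | (N <= n)%N] => //; exists N.
apply: ge_ereal_sup => _ [n /= Nn <-].
have n0 : 0 < n%:R :> R by rewrite ltr0n (leq_trans _ Nn).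
have growth : (K * n.+2)%:R <= expR (e * n%:R).
  apply: le_trans (expR_ge1Dxn 1 _); last by rewrite mulr_ge0 ?ltW.
  have : 6 * K%:R < e ^+ 2 * n%:R.
    rewrite -ltr_pdivrMl ?exprn_gt0// mulrC.
    by rewrite (lt_le_trans (truncnS_gt _))// ler_nat.
  rewrite -(ltr_pM2r n0) => lb.
  have n1 : (n.+2%:R : R) <= 3 * n%:R.
    rewrite -natrM ler_nat; move: Nn; rewrite /N; lia.
  rewrite natrM; have := ler_wpM2l (ler0n R K) n1; rewrite exprMn factS muln1; lra.
have -> : e%:E = ((n%:R^-1)%:E * (e * n%:R)%:E)%E.
  by rewrite -EFinM mulrC mulfK// gt_eqF.
apply: lee_wpmul2l; first by rewrite lee_fin invr_ge0.
rewrite -[X in (_ <= X%:E)%E]expRK -lne_EFin ?expR_gt0// lee_lne.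
- by rewrite (le_trans (NK n))// lee_fin.
- by rewrite in_itv/= leey andbT (le_trans _ (N1 n)).
- by rewrite in_itv/= leey andbT lee_fin expR_ge0.
Unshelve. all: by end_near. Qed.

Theorem theoremE (R : realType) (lambda : nat -> R)
    (hlambda : forall n : nat, (1 <= n)%N -> 0 < lambda n < 1)
    (hsum : (\sum_(1 <= n <oo) (1 - lambda n)%:E < +oo)%E) :
  htop (fun n : nat => blaschke2 (lambda n)) = 0%E.
Proof.
by apply: htop_eq0_linear => delta; exact: card_separated_linear.
Qed.
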